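(* Let $G$ be a virtually nilpotent group. Let $M\subseteq G$ be a subsemigroup containing the identity $e$, and let $F\subseteq N_G(M)$ be finite and non-empty. Set $A:=FM$. Assume that either (i) $F$ is symmetric (i.e. $F^{-1}=F$), or (ii) $F$ semigroup-generates $\langle F\rangle$. Then $A$ is an asymptotic approximate group.
   Context: $\mathbb N=\{1,2,3,\dots\}$. For subsets $E,F$ of a group $G$: $EF=\{ef:e\in E,f\in F\}$, $E^{-1}=\{e^{-1}:e\in E\}$, and for $h\ge1$, $E^h$ is the set of products of exactly $h$ elements of $E$. $\langle E\rangle$ is the subgroup generated by $E$. A group is virtually nilpotent if it contains a nilpotent subgroup of finite index (it need not be finitely generated). A subsemigroup of $G$ is a subset closed under multiplication. For a subsemigroup $M\subseteq G$ containing $e$, $N_G(M):=\{g\in G:gMg^{-1}=M\}$. A non-empty set $F$ semigroup-generates $\langle F\rangle$ if $\langle F\rangle=\bigcup_{h\ge1}F^h$. For $r,l\in\mathbb N$, a non-empty set $A\subseteq G$ is an asymptotic $(r,l)$-approximate group if there is $h_0\in\mathbb N$ such that for every integer $h\ge h_0$ there is a set $X_h\subseteq G$ with $|X_h|\le l$ and $A^{rh}\subseteq X_hA^h$. $A$ is an asymptotic approximate group if for every $r\in\mathbb N$ there exists $l=l(A,r)\in\mathbb N$ such that $A$ is an asymptotic $(r,l)$-approximate group. *)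

(* Defs.v *)
From mathcomp Require Import all_boot.
From mathcomp Require Import boolp classical_sets functions cardinality.

Set Implicit Arguments.
Unset Strict Implicit.
Unset Printing Implicit Defensive.

Local Open Scope classical_set_scope.
Local Open Scope card_scope.
Local Open Scope group_scope.

(* [groupType] is the structure of possibly infinite groups; subsets of [G] are
   Prop-valued ([set G]). *)
Section Group.
Variable G : groupType.
Implicit Types (E F H A M : set G) (r l h n : nat).

Definition setmul E F : set G := [set x * y | x in E & y in F].

Definition setinv E : set G := [set x^-1 | x in E].

(* The products of exactly [h] elements of [E]; the convention [setpow E 0 = 1]
   only initializes the recursion. *)
Definition setpow E h : set G := iter h (setmul E) [set 1].

Definition subgroup H : Prop := group_closed [in H].

Definition gen E : set G := smallest subgroup E.

(* [lcs H 0 = H] and [lcs H n.+1 = [lcs H n, H]]. *)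
Fixpoint lcs H n : set G :=
  if n is n'.+1 then gen [set [~ x, y] | x in lcs H n' & y in H] else H.

Definition nilpotent H : Prop := exists n, lcs H n = [set 1].

Definition finite_index H : Prop :=
  finite_set (range (fun g : G => setmul [set g] H)).

Definition virtually_nilpotent : Prop :=
  exists H, [/\ subgroup H, nilpotent H & finite_index H].

Definition normalizer M : set G :=
  [set g | [set g * m * g^-1 | m in M] = M].

Definition semigroup_generates F : Prop :=
  gen F = \bigcup_(h in [set h | 0 < h]%N) setpow F h.

(* Here and below the positivity conditions reflect that the parameters [r],
   [l] and [h0] range over the positive integers. *)
Definition asymptotic_rl_approximate_group r l A : Prop :=
  A !=set0 /\
  exists2 h0, (0 < h0)%N &
    forall h, (h0 <= h)%N ->
      exists2 X : set G, X #<= `I_l &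
        setpow A (r * h) `<=` setmul X (setpow A h).

Definition asymptotic_approximate_group A : Prop :=
  forall r, (0 < r)%N ->
    exists2 l, (0 < l)%N & asymptotic_rl_approximate_group r l A.

End Group.

Arguments virtually_nilpotent G : clear implicits.

(* Main.v *)
(* Since [F] normalizes [M], one has [(F M)^h = F^h M], so it suffices to cover
   [F^(r h)] by boundedly many left translates of [F^h].  In both cases [F^-1] is
   contained in some [F^Q], which reduces this to the covering of balls of radius
   [r n] by boundedly many balls of radius [O(n)] in the word metric of a finite
   symmetric set [T]; by Schreier's rewriting, [T] may be taken inside a
   nilpotent group.

   There, let [t_0, ..., t_(N-1)] list the iterated brackets of elements of [T]
   by increasing weight (number of leaves); brackets of large weight vanish.  The
   subgroups [H_i] generated by [t_i, ..., t_(N-1)] form a central series with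
   cyclic factors.  Balls are covered modulo [H_i], by
   induction on [i]: collecting shows that an element of [H_i] of word length
   [O(n)] is [t_i ^ a] modulo [H_(i+1)] with [a = O(n ^ w_i)], and conversely
   [t_i ^ b] with [b <= n ^ w_i] has length [O(n)] modulo [H_(i+1)], because the
   bracket is bilinear modulo brackets of larger weight.  Cutting the range of
   [a] into boundedly many intervals of length [n ^ w_i] refines the covering. *)

Require Import Defs.
From mathcomp Require Import all_boot.
From mathcomp Require Import boolp classical_sets functions cardinality.
From mathcomp Require Import zify.

Set Implicit Arguments.
Unset Strict Implicit.
Unset Printing Implicit Defensive.

Local Open Scope classical_set_scope.
Local Open Scope group_scope.

(** * Generated subgroups, commutator identities and congruence modulo a subgroup *)

Section Subgroups.
Variable G : groupType.
Implicit Types (x y z : G) (E H K : set G).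

Lemma subgroupP H : subgroup H <->
  [/\ H 1, forall x y, H x -> H y -> H (x * y) & forall x, H x -> H x^-1].
Proof.
have inH x : (x \in [in H]) = (x \in H) by [].
split=> [gH|[H1 HM HV]].
  have := group_closedM gH; have := group_closedV gH.
  case: gH => + _; rewrite inH => /set_mem H1 HV HM.
  split=> // [x y Hx Hy|x Hx]; apply: set_mem.
  - by apply: HM; rewrite inH; apply: mem_set.
  - by apply: HV; rewrite inH; apply: mem_set.
split; first by rewrite inH; apply: mem_set.
move=> x y; rewrite !inH => /set_mem Hx /set_mem Hy.
by apply: mem_set; apply: HM => //; apply: HV.
Qed.

Lemma sub_gen E x : E x -> gen E x.
Proof. exact: sub_gen_smallest. Qed.

Lemma gen_ind E K : K 1 -> (forall x y, K x -> K y -> K (x * y)) ->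
  (forall x, K x -> K x^-1) -> E `<=` K -> gen E `<=` K.
Proof. by move=> K1 KM KV EK; apply: smallest_sub => //; apply/subgroupP. Qed.

Lemma subgroup_gen E : subgroup (gen E).
Proof.
apply/subgroupP; split.
- by move=> K [/subgroupP[]].
- move=> x y Ex Ey K KP; case: (KP) => /subgroupP[_ KM _] _.
  by apply: KM; [apply: Ex|apply: Ey].
- by move=> x Ex K KP; case: (KP) => /subgroupP[_ _ KV] _; apply: KV; apply: Ex.
Qed.

Lemma gen1 E : gen E 1.
Proof. by case: (subgroupP (gen E)).1; [exact: subgroup_gen|]. Qed.

Lemma genM E x y : gen E x -> gen E y -> gen E (x * y).
Proof. by case: ((subgroupP (gen E)).1 (@subgroup_gen E)) => _ + _; apply. Qed.

Lemma genV E x : gen E x -> gen E x^-1.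
Proof. by case: ((subgroupP (gen E)).1 (@subgroup_gen E)) => _ _; apply. Qed.

Lemma genX E x n : gen E x -> gen E (x ^+ n).
Proof.
move=> Ex; elim: n => [|n IHn]; first by rewrite expg0; apply: gen1.
by rewrite expgS; apply: genM.
Qed.

Lemma gen_sub E E' : E `<=` gen E' -> gen E `<=` gen E'.
Proof. by move=> EE'; apply: smallest_sub => //; apply: subgroup_gen. Qed.

Definition normalized K E := forall x y, K x -> E y -> K (x ^ y).

Definition commutes_mod K E E' := forall x y, E x -> E' y -> K [~ x, y].

Lemma commgMl x y z : [~ x * y, z] = [~ x, z] ^ y * [~ y, z].
Proof. by rewrite /commg /conjg !invgM !mulgA ?(mulgK, mulgVK). Qed.

Lemma commgMr x y z : [~ x, y * z] = [~ x, z] * [~ x, y] ^ z.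
Proof. by rewrite /commg /conjg !invgM !mulgA ?(mulgK, mulgVK). Qed.

Lemma conjg_commg x y : x ^ y = x * [~ x, y].
Proof. by rewrite commgEl mulVKg. Qed.

Lemma conjgX_fix x y s : [~ x, y] = 1 -> x ^ (y ^+ s) = x.
Proof. by move=> /eqP/commgP xy; apply/conjg_fixP/commgP/commuteX. Qed.

(** As [E] is symmetric, every element of [gen E] is a word in [E], so the induction prepends one
    generator at a time and has no inverse step. *)
Lemma gen_ind_left E (P : set G) : (forall x, E x -> E x^-1) -> P 1 ->
  (forall x y, E x -> gen E y -> P y -> P (x * y)) -> gen E `<=` P.
Proof.
move=> EV P1 PM.
(* [Q] is closed under products but not evidently under inverses; hence [QQ] carries [x] and [x^-1]
   together. *)
pose Q x := gen E x /\ forall y, gen E y -> P y -> P (x * y).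
have QM x y : Q x -> Q y -> Q (x * y).
  move=> [Ex Qx] [Ey Qy]; split=> [|z Ez Pz]; first exact: genM.
  by rewrite -mulgA; apply: Qx; [exact: genM|exact: Qy].
have Q1 : Q 1 by split=> [|y _]; rewrite ?mul1g //; exact: gen1.
have QE x : E x -> Q x by move=> Ex; split=> [|y]; [exact: sub_gen|exact: PM].
have QQ : gen E `<=` [set x | Q x /\ Q x^-1].
  apply: gen_ind => //=.
  - by rewrite invg1.
  - by move=> x y [Qx Qx'] [Qy Qy']; rewrite invgM; split; apply: QM.
  - by move=> x [Qx Qx']; rewrite invgK.
  - by move=> x Ex; split; apply: QE => //; apply: EV.
by move=> x /QQ[[_ Qx] _]; rewrite -(mulg1 x); apply: Qx => //; apply: gen1.
Qed.

Lemma normalized_gen E E' : (forall x, E' x -> E' x^-1) ->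
  (forall x y, E x -> E' y -> gen E (x ^ y)) -> normalized (gen E) (gen E').
Proof.
move=> E'V EE' x y Ex E'y.
move: E'y x Ex; apply: (gen_ind_left E'V (P := [set y | forall x, _ -> _])) => /=.
  by move=> x; rewrite conjg1.
move=> y1 y2 E'y1 _ IH x Ex; rewrite conjgM; apply: IH.
move: x Ex; apply: (gen_ind (K := [set x | gen E (x ^ y1)])) => /=.
- by rewrite conj1g; apply: gen1.
- by move=> a b Ha Hb; rewrite conjMg; apply: genM.
- by move=> a Ha; rewrite conjVg; apply: genV.
- by move=> a Ha; apply: EE'.
Qed.

(** Commutators of products expand into conjugates of commutators, which stay in [K] because both
    generated subgroups normalize it. *)
Lemma commutes_mod_gen K E E' : (forall x, E x -> E x^-1) ->
  (forall x, E' x -> E' x^-1) -> subgroup K ->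
  normalized K (gen E) -> normalized K (gen E') ->
  commutes_mod K E E' -> commutes_mod K (gen E) (gen E').
Proof.
move=> EV E'V /subgroupP[K1 KM _] nE nE' c x y Ex E'y.
move: E'y x Ex; apply: (gen_ind_left E'V (P := [set y | forall x, _ -> _])) => /=.
  by move=> x _; rewrite commg1.
move=> y1 y2 E'y1 E'y2 IH x Ex; rewrite commgMr; apply: (KM); first exact: IH.
apply: nE' => //; move: x Ex.
apply: (gen_ind_left EV (P := [set x | K [~ x, y1]])) => /=.
  by rewrite comm1g.
by move=> a b Ea Eb Kb; rewrite commgMl; apply: KM => //; apply: nE => //; apply: c.
Qed.

(** Equality of left cosets of [K]. No quotient group is formed: products and inverses respect it
    for elements that normalize [K]. *)
Definition eqmodg K x y := K (x^-1 * y).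

Section Congruence.
Variables (K N : set G).
Hypotheses (gK : subgroup K) (gN : subgroup N) (nK : normalized K N).

Let K1 : K 1. Proof. by case: (subgroupP K).1. Qed.
Let KM x y : K x -> K y -> K (x * y).
Proof. by case: ((subgroupP K).1 gK) => _ + _; apply. Qed.
Let KV x : K x -> K x^-1.
Proof. by case: ((subgroupP K).1 gK) => _ _; apply. Qed.
Let NV x : N x -> N x^-1.
Proof. by case: ((subgroupP N).1 gN) => _ _; apply. Qed.

Lemma eqmodg_refl x : eqmodg K x x.
Proof. by rewrite /eqmodg mulVg. Qed.

Lemma eqmodg_sym x y : eqmodg K x y -> eqmodg K y x.
Proof. by move=> /KV; rewrite /eqmodg invgM invgK. Qed.

Lemma eqmodg_trans y x z : eqmodg K x y -> eqmodg K y z -> eqmodg K x z.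
Proof. by move=> /KM h /h; rewrite /eqmodg mulgA mulgK. Qed.

Lemma eqmodgM x x' y y' : N y -> eqmodg K x x' -> eqmodg K y y' ->
  eqmodg K (x * y) (x' * y').
Proof.
move=> Ny /nK/(_ Ny) Kx Ky; rewrite /eqmodg.
have -> : (x * y)^-1 * (x' * y') = (x^-1 * x') ^ y * (y^-1 * y').
  by rewrite /conjg !invgM !mulgA ?(mulgK, mulgVK).
exact: KM.
Qed.

Lemma eqmodgV x y : N x -> eqmodg K x y -> eqmodg K x^-1 y^-1.
Proof.
move=> Nx /KV/nK/(_ (NV Nx)); rewrite /eqmodg.
by rewrite /conjg !invgM !invgK !mulgA ?(mulgK, mulgVK).
Qed.

Lemma eqmodgMr x z : K z -> eqmodg K x (x * z).
Proof. by rewrite /eqmodg mulKg. Qed.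

End Congruence.
End Subgroups.

(** * Products of exactly [n] elements, and word balls *)

Section Powers.
Variable G : groupType.
Implicit Types (x y z : G) (E F : set G).

Lemma setpow1 E x : E x -> setpow E 1 x.
Proof. by move=> Ex; exists x => //; exists 1 => //; rewrite mulg1. Qed.

Lemma setpowM E m n x y : setpow E m x -> setpow E n y -> setpow E (m + n) (x * y).
Proof.
elim: m x => [|m IHm] x /=; first by move=> ->; rewrite mul1g.
by move=> [a Ea [b Eb <-]] Ey; exists a => //;
  exists (b * y); rewrite ?mulgA //; exact: IHm.
Qed.

Lemma setpow_split E m n z : setpow E (m + n) z ->
  exists x y, [/\ setpow E m x, setpow E n y & z = x * y].
Proof.
elim: m z => [|m IHm] z; first by exists 1, z; split=> //; rewrite mul1g.
move=> [a Ea [b /IHm[x [y [Ex Ey ->]]] <-]].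
by exists (a * x), y; split; rewrite ?mulgA //; exists a => //; exists x.
Qed.

Lemma setpowX E n k x : setpow E n x -> setpow E (k * n) (x ^+ k).
Proof.
move=> Ex; elim: k => [|k IHk]; first by rewrite expg0.
by rewrite expgS mulSn; apply: setpowM.
Qed.

Lemma setpow_comp E F k n : E `<=` setpow F k -> setpow E n `<=` setpow F (n * k).
Proof.
move=> EF; elim: n => [|n IHn] z /=; first by move=> ->.
by move=> [a /EF Fa [b /IHn Fb <-]]; rewrite mulSn; apply: setpowM.
Qed.

Lemma setpow_sub E F n : E `<=` F -> setpow E n `<=` setpow F n.
Proof.
by move=> EF; rewrite -[X in setpow F X]muln1; apply: setpow_comp => x /EF /setpow1.
Qed.

Lemma setpow_leq E m n : E 1 -> m <= n -> setpow E m `<=` setpow E n.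
Proof.
move=> E1 /subnK <- x Ex; rewrite -(mul1g x); apply: setpowM => //.
by rewrite -(expg1n _ (n - m)) -[X in setpow E X]muln1; apply/setpowX/setpow1.
Qed.

Lemma setpowV E n x : (forall y, E y -> E y^-1) -> setpow E n x -> setpow E n x^-1.
Proof.
move=> EV; elim: n x => [|n IHn] x; first by move=> ->; rewrite /= invg1.
move=> [a Ea [b Eb <-]]; rewrite invgM -addn1; apply: setpowM; first exact: IHn.
exact/setpow1/EV.
Qed.

Lemma setpow_gen E n : setpow E n `<=` gen E.
Proof.
elim: n => [|n IHn] z /=; first by move=> ->; apply: gen1.
by move=> [a Ea [b Eb <-]]; apply: genM; [exact: sub_gen|exact: IHn].
Qed.

Lemma gen_setpow E x : (forall y, E y -> E y^-1) -> gen E x -> exists n, setpow E n x.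
Proof.
move=> EV; move: x.
apply: (gen_ind_left EV (P := [set x | exists n, setpow E n x])) => /=; first by exists 0.
by move=> x y Ex _ [n Ey]; exists n.+1; exists x => //; exists y.
Qed.

Lemma finite_setpow_bound E F : (forall y, E y -> E y^-1) -> E 1 ->
  finite_set F -> F `<=` gen E -> exists k, F `<=` setpow E k.
Proof.
move=> EV E1 /finite_seqP[s ->]; elim: s => [|x s IHs] sE; first by exists 0.
have [|k sk] := IHs; first by move=> y ys; apply: sE; rewrite /= inE; apply/orP; right.
have [|m xm] := @gen_setpow E x EV; first by apply: sE; rewrite /= mem_head.
exists (maxn k m) => y /=; rewrite inE => /predU1P[->|/sk yk].
  exact: (setpow_leq E1 (leq_maxr k m)).
exact: (setpow_leq E1 (leq_maxl k m)).
Qed.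

(* Choosing a representative of each colour covers [E ^ (r * n)] by [#|I|] left
   translates of [E ^ (C * n)], where [C] does not depend on [r]. *)
Definition doubling E := exists C, forall r, exists I : finType,
  forall n, 0 < n -> exists phi : G -> I, forall g g',
    setpow E (r * n) g -> setpow E (r * n) g' -> phi g = phi g' ->
    setpow E (C * n) (g^-1 * g').

End Powers.

(** * Collection along a list of letters sorted by weight *)

Section Collection.
Variables (G : groupType) (N W : nat) (t : nat -> G) (w : nat -> nat).
Hypothesis w_bounds : forall i, i < N -> 0 < w i <= W.
Hypothesis w_mono : forall i j, i <= j -> j < N -> w i <= w j.
Hypothesis t_inv : forall i, i < N ->
  exists j, [/\ j < N, w j = w i & t j = (t i)^-1].
Hypothesis t_comm : forall i j, i < N -> j < N -> [~ t i, t j] = 1 \/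
  exists k, [/\ k < N, w k = (w i + w j)%N & t k = [~ t i, t j]].

Definition letter i v x :=
  exists j, [/\ i <= j, j < N, w j = v & x = t j \/ x = (t j)^-1].

Lemma letterV i v x : letter i v x -> letter i v x^-1.
Proof.
move=> [j [ij jN wj]] x_t; exists j; split => //.
by case: x_t => ->; [right|left; rewrite invgK].
Qed.

Lemma letterW i j v x : i <= j -> letter j v x -> letter i v x.
Proof. by move=> ij [k [jk kN wk xk]]; exists k; split=> //; apply: leq_trans jk. Qed.

(** The inverse of a letter occurs in the list with the same weight, but possibly at an index below
    [i], so the index bound is lost. *)
Lemma letter0E i v x : letter i v x -> exists j, [/\ j < N, w j = v & t j = x].
Proof.
move=> [j [ij jN wj]] [] ->; first by exists j.
by have [k [kN wk tk]] := t_inv jN; exists k; rewrite wk.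
Qed.

Lemma letter_bounds i v x : letter i v x -> [/\ 0 < v, v <= W & i < N -> w i <= v].
Proof.
move=> [j [ij jN <- _]]; have /andP[] := w_bounds jN; split=> // _.
exact: w_mono.
Qed.

(** A nontrivial bracket weighs strictly more than [x], and the list is sorted by weight; hence its
    index exceeds that of [x]. *)
Lemma letter_comm i v v' x y : letter i v x -> letter 0 v' y ->
  [~ x, y] = 1 \/ letter i.+1 (v + v') [~ x, y].
Proof.
move=> xl yl; have [_ _ _] := letter_bounds xl.
have [v'0 _ _] := letter_bounds yl.
have [j [ij jN wj _]] := xl.
have [jx [jxN wjx <-]] := letter0E xl; have [jy [jyN wjy <-]] := letter0E yl.
have [->|[k [kN wk <-]]] := t_comm jxN jyN; first by left.
right; exists k; split=> //; [|by rewrite wk wjx wjy|by left].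
apply: (leq_ltn_trans ij); rewrite ltnNge; apply/negP => kj.
by have := w_mono kj jN; lia.
Qed.

(** These are the terms [H_i] of the central series with cyclic factors. *)
Definition tail i := gen [set x | exists v, letter i v x].

Lemma tail_letter i v x : letter i v x -> tail i x.
Proof. by move=> xl; apply: sub_gen; exists v. Qed.

Lemma tailW i j : i <= j -> tail j `<=` tail i.
Proof. by move=> ij; apply: gen_sub => x [v /(letterW ij)]; apply: tail_letter. Qed.

Lemma tail_out x : tail N x -> x = 1.
Proof.
move: x; apply: gen_ind => //=.
- by move=> x y -> ->; rewrite mulg1.
- by move=> x ->; rewrite invg1.
- by move=> x [v [j [ij]]]; rewrite ltnNge ij.
Qed.

Lemma letter_symm i x : (exists v, letter i v x) -> exists v, letter i v x^-1.
Proof. by move=> [v /letterV]; exists v. Qed.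

Lemma tail_normalized i : normalized (tail i) (tail 0).
Proof.
apply: normalized_gen => [x|x y [v xl] [v' yl]]; first exact: letter_symm.
rewrite conjg_commg; apply: genM; first exact: tail_letter xl.
have [->|] := letter_comm xl yl; first exact: gen1.
by move=> /(letterW (leqnSn i)); apply: tail_letter.
Qed.

Lemma tail_central i : commutes_mod (tail i.+1) (tail i) (tail 0).
Proof.
apply: commutes_mod_gen => [x|x||||x y [v xl] [v' yl]]; try exact: letter_symm.
- exact: subgroup_gen.
- by move=> x y xi yi; apply: tail_normalized => //; apply: tailW yi.
- exact: tail_normalized.
- by have [->|/tail_letter] := letter_comm xl yl; first exact: gen1.
Qed.

(* A letter of weight [v] costs [n ^ (W - v)], so that a word of cost
   [K * n ^ W] has at most [K * n ^ v] letters of weight [v]. *)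
Inductive cost_le i n : nat -> G -> Prop :=
| cost_le1 c : cost_le i n c 1
| cost_leM v c x g : letter i v x -> cost_le i n c g ->
    cost_le i n (n ^ (W - v) + c) (x * g).

Lemma cost_leW i n c c' g : c <= c' -> cost_le i n c g -> cost_le i n c' g.
Proof.
move=> + gc; elim: gc c' => [c0 c' _|v c0 x h xl _ IH c' le_c]; first exact: cost_le1.
have -> : c' = (n ^ (W - v) + (c' - n ^ (W - v)))%N by lia.
by apply: cost_leM => //; apply: IH; lia.
Qed.

Lemma cost_le_mul i n c c' g g' :
  cost_le i n c g -> cost_le i n c' g' -> cost_le i n (c + c') (g * g').
Proof.
move=> gc g'c; elim: gc => [c0|v c0 x h xl _ IH].
  by rewrite mul1g; apply: cost_leW g'c; lia.
by rewrite -mulgA -addnA; apply: cost_leM.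
Qed.

Lemma cost_le_letter i n v x : letter i v x -> cost_le i n (n ^ (W - v)) x.
Proof.
by move=> xl; rewrite -(mulg1 x) -[X in cost_le _ _ X]addn0; apply/cost_leM/cost_le1.
Qed.

Lemma cost_leX i n c g k : cost_le i n c g -> cost_le i n (k * c) (g ^+ k).
Proof.
move=> gc; elim: k => [|k IHk]; first by rewrite expg0; exact: cost_le1.
by rewrite expgS mulSn; apply: cost_le_mul.
Qed.

Lemma cost_le_tail i n c g : cost_le i n c g -> tail i g.
Proof.
elim=> [c0|v c0 x h xl _ IH]; first exact: gen1.
by apply: genM => //; apply: tail_letter xl.
Qed.

(** [D] is the length of one fixed word for [g], chosen before [n]; each of its letters has weight
    at least [v0]. *)
Lemma tail_cost i v0 g : (forall j, i <= j -> j < N -> v0 <= w j) -> tail i g ->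
  exists D, forall n, 0 < n -> cost_le i n (D * n ^ (W - v0)) g.
Proof.
move=> v0w; move: g; apply: (gen_ind_left (@letter_symm i)
  (P := [set g | exists D, forall n, 0 < n -> cost_le i n (D * n ^ (W - v0)) g])) => /=.
  by exists 0 => n _; apply: cost_le1.
move=> x g [v xl] _ [D gD]; exists D.+1 => n n0; rewrite mulSn.
apply: cost_le_mul; last exact: gD.
apply: cost_leW (cost_le_letter n xl); apply: leq_pexp2l => //.
by have [j [ij jN <- _]] := xl; apply: leq_sub2l; apply: v0w.
Qed.

(** Growth of the cost under conjugation: [1] accounts for the letter itself, [K] times the previous
    factor for the brackets that it sheds. The depth [d] bounds the weight still available. *)
Fixpoint conj_factor K d := if d is d'.+1 then (1 + K * conj_factor K d')%N else 1%N.

(* [x ^ y ^+ s.+1 = x ^ y ^+ s * [~ x, y] ^ y ^+ s], and [[~ x, y]] is a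
   letter whose cost is [n ^ w i] times smaller than that of [x]. *)
Lemma cost_le_conj i K n d v x y s : i < N -> 0 < n -> W <= v + d ->
  letter i.+1 v x -> letter 0 (w i) y -> s <= K * n ^ w i ->
  cost_le i.+1 n (conj_factor K d * n ^ (W - v)) (x ^ (y ^+ s)).
Proof.
move=> iN n0; elim: d v x s => [|d IHd] v x s Wd xl yl sK /=.
  have xy1 : [~ x, y] = 1.
    have [//|xyl] := letter_comm xl yl.
    have [_ + _] := letter_bounds xyl; have /andP[+ _] := w_bounds iN; lia.
  by rewrite conjgX_fix // mul1n; apply: cost_le_letter.
have main s' : s' <= s ->
    cost_le i.+1 n (n ^ (W - v) + s' * (conj_factor K d * n ^ (W - (v + w i))))
      (x ^ (y ^+ s')).
  elim: s' => [_|s' IHs' s's].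
    by rewrite expg0 conjg1 addn0; apply: cost_le_letter.
  rewrite expgS conjgM (conjg_commg x y) conjMg mulSn addnCA addnC.
  apply: cost_le_mul; first by apply: IHs'; lia.
  have [->|xyl] := letter_comm xl yl; first by rewrite conj1g; apply: cost_le1.
  apply: IHd => //; [|exact: (letterW (leqnSn _))|by lia].
  by have /andP[+ _] := w_bounds iN; lia.
(* Subtraction is truncated, so splitting [W - v] as [w i + (W - (v + w i))] requires
   [v + w i <= W]; beyond that the bracket vanishes. *)
have [vW|vW] := leqP (v + w i) W; last first.
  have xy1 : [~ x, y] = 1.
    by have [//|/letter_bounds[_ + _]] := letter_comm xl yl; lia.
  rewrite conjgX_fix //.
  by apply: cost_leW (cost_le_letter n xl); rewrite mulnDl mul1n leq_addr.
apply: cost_leW (main s (leqnn s)); rewrite mulnDl mul1n leq_add2l.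
have -> : (W - v = w i + (W - (v + w i)))%N by lia.
have := leq_mul sK (leqnn (conj_factor K d * n ^ (W - (v + w i)))).
by rewrite expnD; lia.
Qed.

(** All occurrences of [t i] and its inverse move to the left, where opposite ones cancel; this
    leaves a natural power of a single [y]. The letters passed over are conjugated by powers of [y],
    which costs the factor [conj_factor K W]. *)
Lemma cost_le_collect i K n c g : i < N -> 0 < n -> c <= K * n ^ W ->
  cost_le i n c g -> exists y a u, [/\ y = t i \/ y = (t i)^-1,
    a * n ^ (W - w i) <= c, cost_le i.+1 n (conj_factor K W * c) u &
    g = y ^+ a * u].
Proof.
move=> iN n0 + gc; elim: gc => [c0|v c0 x h xl _ IH] cK.
  by exists (t i), 0, 1; split; rewrite ?expg0 ?mulg1 //; [left|exact: cost_le1].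
have [|y [a [u [yt ac uc ->]]]] := IH; first by lia.
have [j [ij jN wj xt]] := xl.
have cf : 0 < conj_factor K W by case: (W) => //= *; lia.
move: ij; rewrite leq_eqVlt => /predU1P[ij|ij].
  subst j; subst v.
  have {xt} [->|xE] : x = y \/ x = y^-1.
    by case: xt yt => -> [] ->; [left|right; rewrite invgK|right|left].
  - exists y, a.+1, u; split=> //; [lia| |by rewrite expgS mulgA].
    by apply: cost_leW uc; nia.
  (* The new letter is [y^-1]. If [a = 0] the sign is still free and [y] is replaced by its inverse;
     otherwise one factor cancels. *)
  - case: a ac => [|a] ac.
      exists x, 1%N, u; split=> //.
      + by rewrite xE; case: yt => ->; [right|left; rewrite invgK].
      + lia.
      + by apply: cost_leW uc; nia.
      + by rewrite expg0 mul1g expg1.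
    exists y, a, u; split=> //; [lia| |by rewrite xE expgS -mulgA mulKg].
    by apply: cost_leW uc; nia.
exists y, a, (x ^ (y ^+ a) * u); split=> //; first by lia.
  rewrite mulnDr; apply: cost_le_mul => //; apply: cost_le_conj => //.
  - by lia.
  - by exists j.
  - by exists i.
  (* Dividing [a * n ^ (W - w i) <= K * n ^ W] by the cost of one letter gives [a <= K * n ^ w i],
     as the conjugation bound requires. *)
  - have /andP[_ wW] := w_bounds iN.
    have nW : 0 < n ^ (W - w i) by rewrite expn_gt0 n0.
    rewrite -(leq_pmul2r nW) -mulnA -expnD subnKC //; lia.
by rewrite /conjg !mulgA mulgV mul1g.
Qed.

(** If [y] has finite order [d] modulo [tail i.+1], then [d] divides [a] and [y ^+ a] is a power of
    the fixed element [y ^+ d], whose cost is known. If the order is infinite, [a = 0]. *)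
Lemma tail_power_cost i y : i < N -> letter i (w i) y -> exists D, forall n a, 0 < n ->
  tail i.+1 (y ^+ a) -> cost_le i.+1 n (D * (a * n ^ (W - w i))) (y ^+ a).
Proof.
move=> iN yl.
have [[d0 [d00 d0t]]|tfree] := pselect (exists d, 0 < d /\ tail i.+1 (y ^+ d)); last first.
  exists 0 => n [|a] _ ya; first by rewrite expg0; apply: cost_le1.
  by case: tfree; exists a.+1.
have ex : exists d, `[< 0 < d /\ tail i.+1 (y ^+ d) >] by exists d0; apply/asboolP.
case: (ex_minnP ex) => d /asboolP[d_gt0 dt] dmin.
have [|D hD] := @tail_cost i.+1 (w i) _ _ dt.
  by move=> j ij jN; apply: w_mono => //; apply: ltnW.
exists D => n a n0 ya.
have ad : a = (a %/ d * d)%N.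
  rewrite {1}(divn_eq a d); case: (posnP (a %% d)) => [->|r0]; first by rewrite addn0.
  suff /dmin : `[< 0 < a %% d /\ tail i.+1 (y ^+ (a %% d)) >].
    by rewrite leqNgt ltn_pmod.
  apply/asboolP; split=> //.
  have -> : y ^+ (a %% d) = ((y ^+ d) ^+ (a %/ d))^-1 * y ^+ a.
    by rewrite {3}(divn_eq a d) expgnDr mulnC expgnA mulKg.
  by apply: genM ya; apply: genV; apply: genX.
have -> : y ^+ a = (y ^+ d) ^+ (a %/ d) by rewrite -expgnA mulnC -ad.
apply: cost_leW (cost_leX (a %/ d) (hD n n0)).
have : a %/ d <= a by apply: leq_div.
nia.
Qed.

(** After collection, the power of [y] in front lies in [tail i.+1] since [g] does, and can be
    rewritten without [t i] at proportional cost. *)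
Lemma cost_le_strip i K : i < N -> exists K', forall n g, 0 < n ->
  tail i.+1 g -> cost_le i n (K * n ^ W) g -> cost_le i.+1 n (K' * n ^ W) g.
Proof.
move=> iN.
have til : letter i (w i) (t i) by exists i; split=> //; left.
have [D1 hD1] := tail_power_cost iN til.
have [D2 hD2] := tail_power_cost iN (letterV til).
exists ((D1 + D2) * K + conj_factor K W * K)%N => n g n0 gt gc.
have [y [a [u [yt ac uc gE]]]] := cost_le_collect iN n0 (leqnn _) gc.
have ya : tail i.+1 (y ^+ a).
  have -> : y ^+ a = g * u^-1 by rewrite gE mulgK.
  by apply: genM => //; apply: genV; apply: cost_le_tail uc.
rewrite gE mulnDl; apply: cost_le_mul; last by rewrite -mulnA.
have : cost_le i.+1 n ((D1 + D2) * (a * n ^ (W - w i))) (y ^+ a).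
  case: yt ya => -> ya.
    by apply: cost_leW (hD1 n a n0 ya); rewrite mulnDl leq_addr.
  by apply: cost_leW (hD2 n a n0 ya); rewrite mulnDl leq_addl.
by apply: cost_leW; rewrite -mulnA leq_mul2l ac orbT.
Qed.

(** This controls the distortion of [tail i]: forbidding the letters of index below [i] changes the
    constant only, uniformly in [n]. *)
Lemma cost_le_tail_bound i R : i <= N -> exists K, forall n g, 0 < n ->
  tail i g -> cost_le 0 n (R * n ^ W) g -> cost_le i n (K * n ^ W) g.
Proof.
elim: i => [_|i IHi iN]; first by exists R.
have [K hK] := IHi (ltnW iN); have [K' hK'] := cost_le_strip K iN.
exists K' => n g n0 gi gc; apply: hK' => //; apply: hK => //.
exact: tailW gi.
Qed.

(** * The filtration by weight, and bilinearity of the bracket modulo larger weight *)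

Definition heavy v := gen [set x | exists v', v <= v' /\ letter 0 v' x].

Lemma heavy_letter v v' x : v <= v' -> letter 0 v' x -> heavy v x.
Proof. by move=> vv' xl; apply: sub_gen; exists v'. Qed.

Lemma heavy_symm v x : (exists v', v <= v' /\ letter 0 v' x) ->
  exists v', v <= v' /\ letter 0 v' x^-1.
Proof. by move=> [v' [vv' /letterV]]; exists v'. Qed.

Lemma heavyW u v : u <= v -> heavy v `<=` heavy u.
Proof.
by move=> uv; apply: gen_sub => x [v' [vv']]; apply: heavy_letter; apply: leq_trans vv'.
Qed.

Lemma heavy_tail0 v : heavy v `<=` tail 0.
Proof. by apply: gen_sub => x [v' [_]]; apply: tail_letter. Qed.

Lemma heavy_normalized v : normalized (heavy v) (tail 0).
Proof.
apply: normalized_gen => [x|x y [v' [vv' xl]] [v'' yl]]; first exact: letter_symm.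
rewrite conjg_commg; apply: genM; first exact: heavy_letter xl.
have [->|] := letter_comm xl yl; first exact: gen1.
by move=> /(letterW (leqnSn 0)); apply: heavy_letter; lia.
Qed.

Lemma heavy_comm p q : commutes_mod (heavy (p + q)) (heavy p) (heavy q).
Proof.
apply: commutes_mod_gen => [x|x||||x y [v [pv xl]] [v' [qv' yl]]]; try exact: heavy_symm.
- exact: subgroup_gen.
- by move=> x y xi /heavy_tail0; apply: heavy_normalized.
- by move=> x y xi /heavy_tail0; apply: heavy_normalized.
- have [->|/(letterW (leqnSn 0))] := letter_comm xl yl; first exact: gen1.
  by apply: heavy_letter; lia.
Qed.

Lemma tail_heavy i : i < N -> heavy (w i).+1 `<=` tail i.+1.
Proof.
move=> iN; apply: gen_sub => x [v [wv [j [_ jN wj xt]]]]; apply: (@tail_letter _ v).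
exists j; split=> //; rewrite ltnNge; apply/negP => ji.
by have := w_mono ji iN; lia.
Qed.

Lemma heavy_eqmodgM v x x' y y' : tail 0 y -> eqmodg (heavy v) x x' ->
  eqmodg (heavy v) y y' -> eqmodg (heavy v) (x * y) (x' * y').
Proof. exact: eqmodgM (@subgroup_gen _ _) (@heavy_normalized v) _ _ _ _. Qed.

Lemma heavy_eqmodgV v x y : tail 0 x ->
  eqmodg (heavy v) x y -> eqmodg (heavy v) x^-1 y^-1.
Proof. exact: eqmodgV (@subgroup_gen _ _) (@subgroup_gen _ _) (@heavy_normalized v) _ _. Qed.

Lemma heavy_refl v x : eqmodg (heavy v) x x.
Proof. exact: eqmodg_refl (@subgroup_gen _ _) _. Qed.

Lemma heavy_sym v x y : eqmodg (heavy v) x y -> eqmodg (heavy v) y x.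
Proof. exact: eqmodg_sym (@subgroup_gen _ _) _ _. Qed.

Lemma heavy_trans v y x z :
  eqmodg (heavy v) x y -> eqmodg (heavy v) y z -> eqmodg (heavy v) x z.
Proof. exact: eqmodg_trans (@subgroup_gen _ _) _ _ _. Qed.

(** The exact identity [commgMl] has an extra conjugation by [x']; its error has weight at least
    [p + q + p], which exceeds [p + q] as [p] is positive. *)
Lemma eqmodg_commgMl p q x x' y : 0 < p -> heavy p x -> heavy p x' -> heavy q y ->
  eqmodg (heavy (p + q).+1) ([~ x, y] * [~ x', y]) [~ x * x', y].
Proof.
move=> p0 px px' qy; rewrite commgMl; apply: heavy_eqmodgM.
- exact: heavy_tail0 (heavy_comm px' qy).
- rewrite (conjg_commg [~ x, y]).
  by refine (eqmodgMr _ (heavyW _ (heavy_comm (heavy_comm px qy) px'))); lia.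
- exact: heavy_refl.
Qed.

Lemma eqmodg_commgXl p q x y m : 0 < p -> heavy p x -> heavy q y ->
  eqmodg (heavy (p + q).+1) ([~ x, y] ^+ m) [~ x ^+ m, y].
Proof.
move=> p0 px qy; elim: m => [|m IHm].
  by rewrite !expg0 comm1g; apply: heavy_refl.
rewrite !expgS; apply: (heavy_trans _ (eqmodg_commgMl p0 px (genX m px) qy)).
apply: heavy_eqmodgM => //.
- by apply: genX; apply: heavy_tail0 (heavy_comm px qy).
- exact: heavy_refl.
Qed.

Lemma eqmodg_commgl p q x x' y : 0 < p -> heavy p x -> heavy q y ->
  eqmodg (heavy p.+1) x x' -> eqmodg (heavy (p + q).+1) [~ x, y] [~ x', y].
Proof.
move=> p0 px qy xx'; rewrite -[x'](mulVKg x).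
have px' : heavy p (x^-1 * x') by apply: heavyW xx'.
apply: (heavy_trans _ (eqmodg_commgMl p0 px px' qy)).
by refine (eqmodgMr _ (heavyW _ (heavy_comm xx' qy))).
Qed.

(** Inverting a commutator swaps its arguments, which transfers congruences from the left argument
    to the right one. *)
Lemma eqmodg_commg_sym p q x y x' y' :
  heavy p x -> heavy q y ->
  eqmodg (heavy (p + q).+1) [~ x, y] [~ x', y'] ->
  eqmodg (heavy (q + p).+1) [~ y, x] [~ y', x'].
Proof.
move=> px qy zE; rewrite -!(invgR x) -(invgR x') (addnC q).
apply: heavy_eqmodgV => //.
- exact: heavy_tail0 (heavy_comm px qy).
Qed.

Lemma eqmodg_commg p q x x' y y' : 0 < p -> 0 < q -> heavy p x -> heavy q y ->
  eqmodg (heavy p.+1) x x' -> eqmodg (heavy q.+1) y y' ->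
  eqmodg (heavy (p + q).+1) [~ x, y] [~ x', y'].
Proof.
move=> p0 q0 px qy xx' yy'.
have px' : heavy p x'.
  by rewrite -[x'](mulVKg x); apply: genM => //; apply: heavyW xx'.
apply: (heavy_trans (eqmodg_commgl p0 px qy xx')).
apply: eqmodg_commg_sym => //; exact: eqmodg_commgl.
Qed.

Lemma eqmodgX v x y m : tail 0 x ->
  eqmodg (heavy v) x y -> eqmodg (heavy v) (x ^+ m) (y ^+ m).
Proof.
move=> x0 xy; elim: m => [|m IHm].
  by rewrite !expg0; apply: heavy_refl.
rewrite !expgS; apply: heavy_eqmodgM => //.
- exact: genX.
Qed.

Lemma eqmodg_commgXr p q x y m : 0 < q -> heavy p x -> heavy q y ->
  eqmodg (heavy (p + q).+1) ([~ x, y] ^+ m) [~ x, y ^+ m].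
Proof.
move=> q0 px qy; rewrite -(invgR y) -(invgR (y ^+ m)) expVgn (addnC p).
apply: heavy_eqmodgV.
- by apply: genX; apply: heavy_tail0 (heavy_comm qy px).
- exact: eqmodg_commgXl.
Qed.

Lemma eqmodg_commgXX p q x y a b : 0 < p -> 0 < q -> heavy p x -> heavy q y ->
  eqmodg (heavy (p + q).+1) ([~ x, y] ^+ (b * a)) [~ x ^+ a, y ^+ b].
Proof.
move=> p0 q0 px qy.
apply: (heavy_trans _ (eqmodg_commgXl a p0 px (genX b qy))).
rewrite expgnA; apply: eqmodgX; last exact: eqmodg_commgXr.
by apply: genX; apply: heavy_tail0 (heavy_comm px qy).
Qed.

(** * Words in a symmetric set [T] of letters of weight one *)

Variable T : set G.
Hypothesis T1 : T 1.
Hypothesis TV : forall x, T x -> T x^-1.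
Hypothesis T_letter : forall x, T x -> exists2 i, i < N & w i = 1%N /\ t i = x.
Hypothesis t_gen : forall i, i < N -> (w i = 1%N /\ T (t i)) \/
  exists j k, [/\ j < N, k < N, (w j + w k)%N = w i & t i = [~ t j, t k]].

Lemma setpow_tail0 n : setpow T n `<=` tail 0.
Proof.
move=> x /setpow_gen; apply: gen_sub => {}x /T_letter[i iN [_ <-]].
by apply: (@tail_letter _ (w i)); exists i; split=> //; left.
Qed.

(** A letter of weight one costs [m ^ W.-1]; for [n = O(m)] the total is [O(m ^ W)]. *)
Lemma setpow_cost n m x : 0 < m -> setpow T n x -> cost_le 0 m (n * m ^ W.-1) x.
Proof.
move=> m0; elim: n x => [|n IHn] x /=; first by move=> ->; apply: cost_le1.
move=> [a /T_letter[i iN [wi <-]] [b /IHn bc <-]]; rewrite mulSn -subn1.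
by apply: cost_leM; [exists i; split=> //; left|rewrite subn1].
Qed.

Lemma setpow_commg m n x y : setpow T m x -> setpow T n y ->
  setpow T (m + n + (m + n)) [~ x, y].
Proof.
move=> mx ny; have -> : [~ x, y] = x^-1 * y^-1 * (x * y) by rewrite /commg /conjg !mulgA.
by apply: setpowM; apply: setpowM => //; apply: setpowV.
Qed.

(* With [x = [~ y, z]], [y] and [z] of weights [p] and [q], and
   [b = b1 * n ^ q + b0], the power [x ^+ b] is congruent to
   [[~ y ^+ b1, z ^+ (n ^ q)] * [~ y, z ^+ b0]], where [b1 <= n ^ p] and
   [b0 <= n ^ q]. *)
Lemma letter_power v : exists C, forall v' x n b, v' <= v -> letter 0 v' x ->
  0 < n -> b <= n ^ v' ->
  exists2 h, setpow T (C * n) h & eqmodg (heavy v'.+1) h (x ^+ b).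
Proof.
elim: v => [|v [C hC]].
  by exists 0 => v' x n b; rewrite leqn0 => /eqP-> /letter_bounds[].
(* The summand [1] serves letters of [T]; the other one pays for two commutators, each of length
   [4 * C * n]. *)
exists (1 + C * 8)%N => v' x n b v'v xl n0 bn.
have [i [iN wi xi]] := letter0E xl; have [v'0 _ _] := letter_bounds xl.
have [[wi1 Tti]|[j [k [jN kN wjk ti]]]] := t_gen iN.
  have v'1 : v' = 1%N by rewrite -wi.
  rewrite xi in Tti.
  exists (x ^+ b); last exact: heavy_refl.
  apply: (setpow_leq T1 (_ : b * 1 <= _)); last exact/setpowX/setpow1.
  by move: bn; rewrite v'1 expn1; nia.
rewrite -{}xi {}ti; move: wi; rewrite -wjk => {}wjk; subst v'.
have wj0 : 0 < w j by case/andP: (w_bounds jN).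
have wk0 : 0 < w k by case/andP: (w_bounds kN).
have jl : letter 0 (w j) (t j) by exists j; split=> //; left.
have kl : letter 0 (w k) (t k) by exists k; split=> //; left.
have jh := heavy_letter (leqnn _) jl; have kh := heavy_letter (leqnn _) kl.
have comm a c : a <= n ^ w j -> c <= n ^ w k ->
    exists2 h, setpow T (4 * C * n) h &
    eqmodg (heavy (w j + w k).+1) h ([~ t j, t k] ^+ (c * a)).
  move=> an cn.
  have [|h1 h1C h1E] := hC _ _ _ _ _ jl n0 an; first by lia.
  have [|h2 h2C h2E] := hC _ _ _ _ _ kl n0 cn; first by lia.
  exists [~ h1, h2].
    by have := setpow_commg h1C h2C; have -> : (C * n + C * n + (C * n + C * n) = 4 * C * n)%N by lia.
  apply: heavy_sym.
  apply: (heavy_trans (eqmodg_commgXX _ _ wj0 wk0 jh kh)).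
  apply: eqmodg_commg => //; try exact: genX.
  - exact: heavy_sym.
  - exact: heavy_sym.
have nk0 : 0 < n ^ w k by rewrite expn_gt0 n0.
have [||h1 h1C h1E] := comm (b %/ n ^ w k)%N (n ^ w k)%N.
- by rewrite -(leq_pmul2r nk0) -expnD (leq_trans (leq_divM _ _)).
- by [].
have [||h2 h2C h2E] := comm 1%N (b %% n ^ w k)%N.
- by rewrite expn_gt0 n0.
- by rewrite ltnW // ltn_pmod.
exists (h1 * h2).
  apply: (setpow_leq T1 (_ : 4 * C * n + 4 * C * n <= _)); first by lia.
  exact: setpowM.
rewrite [in X in eqmodg _ _ X](divn_eq b (n ^ w k)%N) expgnDr [(_ %/ _ * _)%N]mulnC.
rewrite muln1 in h2E; apply: heavy_eqmodgM => //.
- exact: setpow_tail0 h2C.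
Qed.

(** * Colouring balls modulo the central series *)

Lemma tail_eqmodgM i x x' y y' : tail 0 y -> eqmodg (tail i) x x' ->
  eqmodg (tail i) y y' -> eqmodg (tail i) (x * y) (x' * y').
Proof. exact: eqmodgM (@subgroup_gen _ _) (@tail_normalized i) _ _ _ _. Qed.

Lemma tail_eqmodgV i x y : tail 0 x ->
  eqmodg (tail i) x y -> eqmodg (tail i) x^-1 y^-1.
Proof. exact: eqmodgV (@subgroup_gen _ _) (@subgroup_gen _ _) (@tail_normalized i) _ _. Qed.

Lemma tail_trans i y x z :
  eqmodg (tail i) x y -> eqmodg (tail i) y z -> eqmodg (tail i) x z.
Proof. exact: eqmodg_trans (@subgroup_gen _ _) _ _ _. Qed.

Definition near i m x := exists2 h, setpow T m h & eqmodg (tail i) h x.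

Lemma nearV i m x : near i m x -> near i m x^-1.
Proof.
move=> [h hm hx]; exists h^-1; first exact: setpowV.
by apply: tail_eqmodgV => //; apply: setpow_tail0 hm.
Qed.

Lemma near_power i : i < N -> exists C, forall y n b, letter 0 (w i) y ->
  0 < n -> b <= n ^ w i -> near i.+1 (C * n) (y ^+ b).
Proof.
move=> iN; have [C hC] := letter_power (w i); exists C => y n b yl n0 bn.
have [h hCn hE] := hC _ _ _ _ (leqnn _) yl n0 bn; exists h => //.
exact: tail_heavy hE.
Qed.

(** Modulo [tail i.+1] the powers of [y] are central, so [g^-1 * g'] is congruent to
    [h^-1 * h' * y ^+ (a' - a)]. *)
Lemma near_step i m k y h h' a a' g g' : letter i (w i) y ->
  setpow T m h -> setpow T m h' -> a <= a' -> near i.+1 k (y ^+ (a' - a)) ->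
  eqmodg (tail i.+1) (h * y ^+ a) g -> eqmodg (tail i.+1) (h' * y ^+ a') g' ->
  near i.+1 (m + m + k) (g^-1 * g').
Proof.
move=> yl hm h'm aa' [b bk bE] hE h'E.
have y0 c : tail 0 (y ^+ c) by apply: genX; apply: tail_letter (letterW (leq0n i) yl).
have h0 := setpow_tail0 hm; have h'0 := setpow_tail0 h'm.
have x0 : tail 0 (h^-1 * h') by apply: genM => //; apply: genV.
exists (h^-1 * h' * b).
  by apply: setpowM => //; apply: setpowM => //; apply: setpowV.
have gE : eqmodg (tail i.+1) (y ^- a * (h^-1 * h') * y ^+ a') (g^-1 * g').
  have -> : y ^- a * (h^-1 * h') * y ^+ a' = (h * y ^+ a)^-1 * (h' * y ^+ a').
    by rewrite invgM !mulgA.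
  apply: tail_eqmodgM => //; first exact: genM h'0 (y0 a').
  by apply: tail_eqmodgV => //; apply: genM h0 (y0 a).
apply: tail_trans gE.
have -> : y ^- a * (h^-1 * h') * y ^+ a' = (h^-1 * h') ^ (y ^+ a) * y ^+ (a' - a).
  by rewrite -{1}(subnKC aa') expgnDr /conjg !mulgA.
apply: tail_eqmodgM => //; first exact: setpow_tail0 bk.
rewrite conjg_commg; refine (eqmodgMr _ _).
rewrite -invgR; apply: genV; apply: tail_central => //.
by apply: genX; apply: tail_letter yl.
Qed.

(** A colour is refined by the sign and the quotient by [n ^ w i] of the exponent of [t i], measured
    from a base point of the old colour class. Equal quotients leave exponents at most [n ^ w i]
    apart, hence a new radius independent of [r]. *)
Lemma coloring i : i <= N -> exists C, forall r, exists I : finType,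
  forall n, 0 < n -> exists phi : G -> I, forall g g',
    setpow T (r * n) g -> setpow T (r * n) g' -> phi g = phi g' ->
    near i (C * n) (g^-1 * g').
Proof.
elim: i => [_|i IHi iN].
  exists 0 => r; exists unit => n n0; exists (fun=> tt) => g g' rg rg' _.
  exists 1; first by [].
  rewrite /eqmodg invg1 mul1g; apply: genM; last exact: setpow_tail0 rg'.
  by apply: genV; apply: setpow_tail0 rg.
have [C hC] := IHi (ltnW iN); have [C' hC'] := near_power iN.
have /andP[wi0 wiW] := w_bounds iN.
exists (C + C + C')%N => r.
have [I hI] := hC r; have [K hK] := cost_le_tail_bound (C + (r + r)) (ltnW iN).
exists (I * bool * 'I_K.+1)%type => n n0.
have [phi phiP] := hI n n0.
(* The default [1] is returned only for colours absent from the ball. *)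
pose base c := xget 1 [set g | setpow T (r * n) g /\ phi g = c].
have baseP g : setpow T (r * n) g ->
    setpow T (r * n) (base (phi g)) /\ phi (base (phi g)) = phi g.
  move=> rg; pose B := [set g' | setpow T (r * n) g' /\ phi g' = phi g].
  exact: (xgetI (P := B) 1 (conj rg erefl)).
pose letter_of (e : bool) := if e then t i else (t i)^-1.
have til : letter i (w i) (t i) by exists i; split=> //; left.
have letter_ofP e : letter i (w i) (letter_of e) by case: e => //; apply: letterV.
have q0 : 0 < n ^ w i by rewrite expn_gt0 n0.
pose P g (d : bool * nat * G) := [/\ d.1.2 <= K * n ^ w i, setpow T (C * n) d.2 &
  eqmodg (tail i.+1) (d.2 * letter_of d.1.1 ^+ d.1.2) ((base (phi g))^-1 * g)].
have /choice[f fP] : forall g, exists d, setpow T (r * n) g -> P g d.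
  move=> g; have [rg|nrg] := pselect (setpow T (r * n) g); last by exists (true, 0, 1) => /nrg.
  have [rb bE] := baseP g rg.
  have [h hCn hE] := phiP _ _ rb rg bE.
  (* The factors have lengths [C * n], [r * n] and [r * n]. Thus [K] depends on [r], but it affects
     only the number of colours. *)
  have zc : cost_le 0 n ((C + (r + r)) * n ^ W) (h^-1 * ((base (phi g))^-1 * g)).
    have : setpow T ((C + (r + r)) * n) (h^-1 * ((base (phi g))^-1 * g)).
      by rewrite !mulnDl; do !apply: setpowM => //; apply: setpowV.
    by move=> /(setpow_cost n0); rewrite -mulnA -expnS prednK //; apply: leq_trans wiW.
  have [y [a [u [yt ac uc uE]]]] := cost_le_collect iN n0 (leqnn _) (hK _ _ n0 hE zc).
  have [e ye] : exists e, y = letter_of e by case: yt => ->; [exists true|exists false].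
  exists (e, a, h) => _; split=> //=.
    have nW : 0 < n ^ (W - w i) by rewrite expn_gt0 n0.
    by rewrite -(leq_pmul2r nW) -mulnA -expnD subnKC.
  rewrite -ye /eqmodg invgM -mulgA uE mulKg; exact: cost_le_tail uc.
exists (fun g => (phi g, (f g).1.1, inord ((f g).1.2 %/ n ^ w i))) => g g' rg rg'.
have [] := fP g rg; have [] := fP g' rg'.
case: (f g) => [[e a] h]; case: (f g') => [[e' a'] h'] /=.
move=> a'K h'C h'E aK hCn hE [phiE ee' aa']; subst e'.
have div_ord b : b <= K * n ^ w i -> b %/ n ^ w i < K.+1.
  by move=> bK; rewrite ltnS -(mulnK K q0) leq_div2r.
have {}aa' : (a %/ n ^ w i = a' %/ n ^ w i)%N.
  by rewrite -(inordK (div_ord a aK)) aa' inordK // div_ord.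
have diff b b' : (b %/ n ^ w i = b' %/ n ^ w i)%N -> (b' - b <= n ^ w i)%N.
  move=> bb'; rewrite {1}(divn_eq b' (n ^ w i)) {1}(divn_eq b (n ^ w i)) bb' subnDl.
  by apply: leq_trans (leq_subr _ _) (ltnW _); apply: ltn_pmod.
have el := letter_ofP e; have e0 := letterW (leq0n i) el.
rewrite phiE in hE; set g0 := base (phi g') in hE h'E.
have -> : g^-1 * g' = (g0^-1 * g)^-1 * (g0^-1 * g') by rewrite invgM !mulgA mulgVK.
rewrite !mulnDl; have [le|/ltnW le] := leqP a a'.
  by apply: near_step hE h'E => //; apply: hC' => //; apply: diff.
(* For [a' <= a] the roles of [g] and [g'] are exchanged by inversion. *)
rewrite -[X in near _ _ X]invgK; apply: nearV; rewrite invgM invgK.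
by apply: near_step h'E hE => //; apply: hC' => //; apply: diff.
Qed.

Lemma doubling_letters : doubling T.
Proof.
have [C hC] := coloring (leqnn N); exists C => r; have [I hI] := hC r.
exists I => n n0; have [phi hphi] := hI n n0; exists phi => g g' rg rg' gg'.
have [h hn hE] := hphi g g' rg rg' gg'.
suff <- : h = g^-1 * g' by [].
by rewrite -[RHS](mulVKg h) (tail_out hE) mulg1.
Qed.

End Collection.

(** * Iterated brackets in a nilpotent group *)

Section Brackets.
Variables (G : groupType) (S H : set G).
Hypotheses (S1 : S 1) (SV : forall x, S x -> S x^-1) (Sfin : finite_set S).
Hypotheses (gH : subgroup H) (SH : S `<=` H).

Inductive bracket : nat -> G -> Prop :=
| bracket_gen x : S x -> bracket 1 x
| bracket_comm i j x y : bracket i x -> bracket j y -> bracket (i + j) [~ x, y].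

Lemma bracket_gt0 v x : bracket v x -> 0 < v.
Proof. by elim=> // i j y z _ i0 _ j0; rewrite addn_gt0 i0. Qed.

Lemma bracketV v x : bracket v x -> bracket v x^-1.
Proof.
case=> [y /SV|i j y z yi zj]; first exact: bracket_gen.
by rewrite invgR addnC; apply: bracket_comm.
Qed.

Lemma bracket_sub v x : bracket v x -> H x.
Proof.
have [_ HM HV] := (subgroupP H).1 gH.
elim=> [y /SH//|i j y z _ Hy _ Hz].
by rewrite /commg /conjg; do !apply: (HM) => //; apply: (HV).
Qed.

(* One of the two halves of a bracket of weight at least [2 ^ d.+1] has weight
   at least [2 ^ d]. *)
Lemma bracket_lcs d v x : bracket v x -> 2 ^ d <= v -> lcs H d x.
Proof.
elim: d v x => [|d IHd] v x xv; first by move=> _; apply: bracket_sub xv.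
case: xv => [y _|i j y z yi zj]; first by rewrite expnS; have := expn_gt0 2 d; lia.
rewrite expnS => ij; have [di|di] := leqP (2 ^ d) i.
  apply: sub_gen; exists y; first exact: IHd yi di.
  by exists z => //; apply: bracket_sub zj.
rewrite -invgR; apply: genV; apply: sub_gen; exists z; first by apply: IHd zj _; lia.
by exists y => //; apply: bracket_sub yi.
Qed.

Lemma bracketE v x : bracket v x -> S x \/
  exists i j y z, [/\ v = (i + j)%N, bracket i y, bracket j z & x = [~ y, z]].
Proof. by case=> [y|i j y z]; [left|right; exists i, j, y, z]. Qed.

Lemma finite_bracket v : finite_set [set x | bracket v x].
Proof.
have [m] := ubnP v; elim: m v => // m IHm v; rewrite ltnS => vm.
pose D := [set i | 0 < i < v].
have Dfin : finite_set D.
  by apply: (sub_finite_set _ (finite_II v)) => i /= /andP[].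
pose B := \bigcup_(i in D)
  [set [~ x, y] | x in [set x | bracket i x] & y in [set y | bracket (v - i) y]].
apply: (@sub_finite_set _ _ (S `|` B)).
  move=> x /= /bracketE[Sx|[i [j [y [z [vE yi zj ->]]]]]]; first by left.
  right; exists i; first by have := bracket_gt0 yi; have := bracket_gt0 zj; rewrite /D /=; lia.
  by exists y => //; exists z => //=; rewrite vE addKn.
rewrite finite_setU; split=> //; apply: bigcup_finite => // i /= /andP[i0 iv].
by apply: finite_image2; apply: IHm; lia.
Qed.

(** The brackets of weight at most [2 ^ c], sorted by weight, satisfy the hypotheses of collection:
    there are finitely many, and heavier ones are trivial. *)
Lemma doubling_nilpotent : nilpotent H -> doubling S.
Proof.
move=> [c Hc].
have big v x : 2 ^ c <= v -> bracket v x -> x = 1.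
  by move=> cv xv; have := bracket_lcs xv cv; rewrite Hc.
(* Pairs are listed because one element may be a bracket of several weights. *)
pose A := [set p : nat * G | p.1 <= 2 ^ c /\ bracket p.1 p.2].
have /finite_seqP[s As] : finite_set A.
  pose B := \bigcup_(v in `I_(2 ^ c).+1) [set (v, x) | x in [set x | bracket v x]].
  apply: (@sub_finite_set _ _ B).
    by move=> [v x] [/= vc xv]; exists v => //; exists x.
  apply: bigcup_finite; first exact: finite_II.
  by move=> v _; apply: finite_image; apply: finite_bracket.
pose le_weight (p q : nat * G) := p.1 <= q.1.
pose L := sort le_weight s.
have LA p : p \in L <-> A p by rewrite mem_sort As.
pose t i := (nth (0, 1) L i).2; pose w i := (nth (0, 1) L i).1.
have LP i : i < size L -> w i <= 2 ^ c /\ bracket (w i) (t i).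
  by move=> /(mem_nth (0, 1)) /LA.
have LE v x : v <= 2 ^ c -> bracket v x ->
    exists i, [/\ i < size L, w i = v & t i = x].
  move=> vc xv; have vxL : (v, x) \in L by apply/LA.
  by exists (index (v, x) L); rewrite /w /t index_mem nth_index.
apply: (@doubling_letters G (size L) (2 ^ c) t w) => //.
- by move=> i /LP[-> /bracket_gt0->].
- move=> i j ij jL; apply: (sorted_leq_nth (leT := le_weight)) => //.
  + by move=> p q r; apply: leq_trans.
  + by move=> p; apply: leqnn.
  + by apply: sort_sorted => p q; apply: leq_total.
  + exact: leq_ltn_trans jL.
- by move=> i /LP[ic /bracketV]; apply: LE.
- move=> i j /LP[ic ib] /LP[jc jb]; have ijb := bracket_comm ib jb.
  have [/big/(_ ijb)|/ltnW/LE/(_ ijb)] := leqP (2 ^ c) (w i + w j); first by left.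
  by right.
- move=> x Sx; have [|i [iL wi ti]] := LE 1%N x _ (bracket_gen Sx).
    by rewrite expn_gt0.
  by exists i.
- move=> i /LP[+ ib]; case: (w i) (t i) / ib => [x Sx _|j k x y xj yk jkc]; first by left.
  right; have [|j' [j'L wj' tj']] := LE _ _ _ xj; first by lia.
  have [|k' [k'L wk' tk']] := LE _ _ _ yk; first by lia.
  by exists j', k'; rewrite wj' wk' tj' tk'.
Qed.

End Brackets.

(** * Schreier rewriting and passage to a subgroup of finite index *)

Section FiniteIndex.
Variables (G : groupType) (T H : set G).
Hypotheses (T1 : T 1) (TV : forall x, T x -> T x^-1) (Tfin : finite_set T).
Hypotheses (gH : subgroup H) (nH : nilpotent H) (iH : finite_index H).

Let H1 : H 1. Proof. by case: ((subgroupP H).1 gH). Qed.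
Let HV x : H x -> H x^-1.
Proof. by case: ((subgroupP H).1 gH) => _ _; apply. Qed.

Lemma coset_representatives : exists2 R : set G,
  [/\ finite_set R, R 1 & R `<=` gen T] &
  forall a, gen T a -> exists2 b, R b & H (b^-1 * a).
Proof.
(* Representatives are taken inside [gen T], so that the Schreier generators have finite length in
   [T]; cosets missing [gen T] get the harmless value [1]. *)
pose rep K := xget 1 (K `&` gen T).
exists ([set 1] `|` rep @` range (fun g => setmul [set g] H)).
  split; last 2 [by left].
  - by rewrite finite_setU; split; [exact: finite_set1|exact: finite_image].
  - move=> x [->|[K _ <-]]; first exact: gen1.
    by rewrite /rep; case: xgetP => [y _ [_ Ty]|_]; [exact: Ty|exact: gen1].
move=> a Ta; pose K := setmul [set a] H.
exists (rep K); first by right; exists K => //; exists a.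
have [] : (K `&` gen T) (rep K).
  by apply: (xgetI 1 (x := a)); split=> //; exists a => //; exists 1; rewrite ?mulg1.
by move=> [_ -> [h Hh <-]] _; rewrite invgM mulgVK; apply: HV.
Qed.

(** A word is read from the right: [x * b'] is rewritten as [b * (b^-1 * (x * b'))], whose second
    factor lies in [H]. Each letter of [T] yields one letter of [S], so lengths are preserved. *)
Lemma schreier_generators : exists R S : set G,
  [/\ finite_set R, finite_set S & S `<=` H `&` gen T] /\
  [/\ S 1, forall x, S x -> S x^-1 &
      forall n g, setpow T n g -> exists b s, [/\ R b, setpow S n s & g = b * s]].
Proof.
have [R [Rfin R1 RT] repP] := coset_representatives.
pose S0 := [set x | H x] `&`
  [set b^-1 * a | b in R & a in [set x * y | x in T & y in R]].
have S0fin : finite_set S0 by apply: finite_setIr; do !apply: finite_image2.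
have S0T : S0 `<=` gen T.
  move=> _ [_ [b /RT Tb [_ [x Tx [y /RT Ty <-]] <-]]].
  apply: genM; first exact: genV.
  by apply: genM => //; apply: sub_gen.
pose S := [set 1] `|` (S0 `|` [set x^-1 | x in S0]).
exists R, S; split; split=> //.
- rewrite !finite_setU; split; first exact: finite_set1.
  by split=> //; apply: finite_image.
- move=> x [->|[x0|[y y0 <-]]]; first by split=> //; apply: gen1.
    by split; [case: x0|exact: S0T].
  by split; [apply: HV; case: y0|exact: genV (S0T _ y0)].
- by left.
- move=> x [->|[x0|[y y0 <-]]]; first by rewrite invg1; left.
    by right; right; exists x.
  by right; left; rewrite invgK.
elim=> [|n IHn] g; first by move=> ->; exists 1, 1; split; rewrite ?mulg1.
move=> [x Tx [g' /IHn[b' [s [Rb' Ss ->]]] <-]].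
have [|b Rb bH] := repP (x * b'); first by apply: genM; [exact: sub_gen|exact: RT].
exists b, (b^-1 * (x * b') * s); split=> //; last by rewrite !mulgA mulgV mul1g.
exists (b^-1 * (x * b')); last by exists s.
right; left; split=> //; exists b => //; exists (x * b') => //.
by exists x => //; exists b'.
Qed.

(** The colour records the coset representative and the colour of the [H]-part. Equal
    representatives cancel in [g^-1 * g'], and [k] converts lengths in [S] back to lengths in
    [T]. *)
Lemma doubling_virtually_nilpotent : doubling T.
Proof.
have [R [S [[Rfin Sfin ST] [S1 SV decomp]]]] := schreier_generators.
have [C hC] : doubling S.
  by apply: (doubling_nilpotent (H := H)) => // x /ST[].
have [k Sk] : exists k, S `<=` setpow T k.
  by apply: finite_setpow_bound => // x /ST[].
have /finite_seqP[Rs RE] := Rfin.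
exists (C * k)%N => r; have [I hI] := hC r.
exists ('I_(size Rs).+1 * I)%type => n n0; have [phi phiP] := hI n n0.
have /choice[f fP] : forall g, exists p : G * G, setpow T (r * n) g ->
    [/\ R p.1, setpow S (r * n) p.2 & g = p.1 * p.2].
  move=> g; have [/decomp[b [s bs]]|ng] := pselect (setpow T (r * n) g).
    by exists (b, s).
  by exists (1, 1) => /ng.
exists (fun g => (inord (index (f g).1 Rs), phi (f g).2)) => g g' rg rg'.
have [] := fP g rg; have [] := fP g' rg'.
case: (f g) => [b s]; case: (f g') => [b' s'] /=; rewrite RE /=.
move=> b'R s'S -> bR sS -> [] /(congr1 val) /=.
rewrite !inordK ?ltnS ?index_size // => /(congr1 (nth 1 Rs)).
rewrite !nth_index // => <- /(phiP _ _ sS s'S) /(setpow_comp Sk).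
by rewrite mulnAC invgM -mulgA mulKg.
Qed.

End FiniteIndex.

(** * Removing [M], exact word lengths, and the final covering *)

Section Main.
Variable G : groupType.
Implicit Types (E F M : set G).

Lemma setpow_normalizer M F z : F `<=` normalizer M -> forall n, setpow F n z ->
  forall m, M m -> exists2 m', M m' & m * z = z * m'.
Proof.
move=> FM n; elim: n z => [|n IHn] z /=.
  by move=> -> m Mm; exists m; rewrite ?mulg1 ?mul1g.
move=> [f /FM fM [z' /IHn zM <-]] m Mm.
(* Equality in the definition of the normalizer gives [m = f * m1 * f^-1], so [m] passes to the
   right of [f]. *)
have : [set f * m * f^-1 | m in M] m by rewrite fM.
move=> [m1 Mm1 mE]; have [m2 Mm2 m2E] := zM m1 Mm1.
by exists m2 => //; rewrite -mE !mulgA mulgVK -(mulgA f) m2E mulgA.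
Qed.

Lemma setpow_setmul M F n : mulg_closed [in M] -> M 1 -> F `<=` normalizer M ->
  setpow (setmul F M) n `<=` setmul (setpow F n) M.
Proof.
move=> MM M1 FM; elim: n => [|n IHn] x /=.
  by move=> ->; exists 1 => //; exists 1; rewrite ?mulg1.
move=> [_ [f Ff [m Mm <-]] [_ /IHn[z zF [m1 Mm1 <-]] <-]].
have [m' Mm' mz] := setpow_normalizer FM zF Mm.
exists (f * z); first by exists f => //; exists z.
exists (m' * m1); last by rewrite !mulgA -(mulgA f m) mz !mulgA.
by apply: set_mem; apply: MM; apply: mem_set.
Qed.

(** The last letter absorbs [m] and the others take [1] from [M]. For [n = 0] there is no letter to
    absorb it. *)
Lemma setmul_setpow M F n : M 1 -> 0 < n ->
  setmul (setpow F n) M `<=` setpow (setmul F M) n.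
Proof.
move=> M1; case: n => // n _; have FFM : F `<=` setmul F M.
  by move=> f Ff; exists f => //; exists 1; rewrite ?mulg1.
move=> _ [z zF [m Mm <-]]; move: zF; rewrite -addn1 => /setpow_split.
move=> [x [_ [xF [f Ff [_ -> <-]] ->]]]; rewrite mulg1 -mulgA.
apply: setpowM; first exact: setpow_sub xF.
by apply: setpow1; exists f => //; exists m.
Qed.

(** Powers have exact length and [1] need not lie in [F], so inverses must share one length [Q];
    that [1] is in [F ^ Q.+1] later allows padding. *)
Lemma inverse_in_setpow F : finite_set F -> F !=set0 ->
  setinv F = F \/ semigroup_generates F ->
  exists Q, setpow F Q.+1 1 /\ forall f, F f -> setpow F Q f^-1.
Proof.
move=> Ffin [f0 Ff0] [FV|FS].
  have inF f : F f -> F f^-1 by rewrite -{2}FV => Ff; exists f.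
  exists 1%N; split=> [|f /inF/setpow1//].
  rewrite -(mulgV f0); apply: (@setpowM _ F 1 1); first exact: setpow1.
  exact/setpow1/inF.
have inF f : F f -> exists Q, setpow F Q.+1 1 /\ setpow F Q f^-1.
  move=> Ff; have : gen F f^-1 by apply: genV; apply: sub_gen.
  rewrite FS => -[Q _ FQ]; exists Q; split=> //.
  by rewrite -(mulgV f) -add1n; apply: setpowM => //; apply: setpow1.
suff FQ : forall s : seq G, [set` s] `<=` F -> exists Q, setpow F Q.+1 1 /\
    forall f, f \in s -> setpow F Q f^-1.
  have /finite_seqP[s sE] := Ffin; have [|Q [Q1 QV]] := FQ s; first by rewrite -sE.
  by exists Q; split=> // f; rewrite {1}sE => /QV.
elim=> [_|f s IHs sF]; first by have [Q [Q1 _]] := inF f0 Ff0; exists Q.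
have [|Q [Q1 QV]] := IHs; first by move=> x xs; apply: sF; rewrite /= inE; apply/orP; right.
have [|q [q1 qV]] := inF f; first by apply: sF; rewrite /= mem_head.
have pow1 k j : setpow F k 1 -> setpow F (j * k) 1.
  by move=> /(setpowX j); rewrite expg1n.
(* The successor of this witness is [Q.+1 * q.+1]; both old lengths reach it by padding with words
   for [1]. *)
exists (Q + Q.+1 * q)%N; split; first by rewrite -addSn -mulnS; apply: pow1.
move=> x; rewrite inE => /predU1P[->|/QV Qx].
  have -> : (Q + Q.+1 * q = q + Q * q.+1)%N by lia.
  by rewrite -(mulg1 f^-1); apply: setpowM => //; apply: pow1.
by rewrite -(mulg1 x^-1) mulnC; apply: setpowM => //; apply: pow1.
Qed.

Lemma card_range_le (K : finType) (f : K -> G) l : #|K| <= l -> (range f #<= `I_l)%card.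
Proof.
move=> Kl; apply: card_le_trans (_ : (`I_#|K| #<= `I_l)%card); last by rewrite card_le_II.
have -> : range f = (f \o enum_val) @` [set: 'I_#|K|].
  apply/seteqP; split=> _ [x _ <-]; last by exists (enum_val x).
  by exists (enum_rank x); rewrite //= enum_rankK.
apply: card_le_trans (card_image_le _ _) _.
by have := @card_II #|K|; rewrite card_eq_le => /andP[].
Qed.

End Main.

Theorem theorem1p6 (G : groupType) (hG : virtually_nilpotent G)
    (M : set G) (hM : mulg_closed [in M]) (hM1 : M 1)
    (F : set G) (hFM : F `<=` normalizer M)
    (hFfin : finite_set F) (hF0 : F !=set0)
    (hF : setinv F = F \/ semigroup_generates F) :
  asymptotic_approximate_group (setmul F M).
Proof.
have [H [gH nH iH]] := hG.
have [Q [FQ1 FQV]] := inverse_in_setpow hFfin hF0 hF.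
have [f0 Ff0] := hF0.
pose P := Q.+1; pose T := [set 1] `|` (F `|` [set x^-1 | x in F]).
have T1 : T 1 by left.
have TV x : T x -> T x^-1.
  move=> [->|[Fx|[y Fy <-]]]; first by rewrite invg1; left.
    by right; right; exists x.
  by right; left; rewrite invgK.
have Tfin : finite_set T.
  rewrite !finite_setU; split; first exact: finite_set1.
  by split=> //; apply: finite_image.
have FT : F `<=` T by move=> f Ff; right; left.
have TF m g : setpow T m g -> exists2 j, (j <= P * m)%N & setpow F j g.
  elim: m g => [|m IHm] g; first by move=> ->; exists 0.
  move=> [x Tx [y /IHm[j jm yj] <-]].
  have [i iP xi] : exists2 i, (i <= P)%N & setpow F i x.
    case: Tx => [->|[Fx|[f Ff <-]]]; first by exists P.
      by exists 1%N => //; apply: setpow1.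
    by exists Q; [exact: leqnSn|exact: FQV].
  by exists (i + j)%N; [rewrite mulnS leq_add|exact: setpowM].
have [C hC] := doubling_virtually_nilpotent T1 TV Tfin gH nH iH.
(* As [C] does not depend on [r], [h0] can be fixed before the radius factor [2 * r * h0]. It makes
   [P * (C * n) <= h], and [C.+1] keeps it positive. *)
move=> r r0; pose h0 := (P * C.+1)%N.
have h00 : (0 < h0)%N by rewrite muln_gt0.
have [I hI] := hC (2 * r * h0)%N.
exists (#|{: I * 'I_P}|).+1 => //; split.
  by exists (f0 * 1); exists f0 => //; exists 1.
exists h0 => // h h0h; pose n := (h %/ h0)%N.
have n0 : (0 < n)%N by rewrite divn_gt0.
have [phi phiP] := hI n n0.
pose base c := xget 1 [set g | setpow F (r * h) g /\ phi g = c].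
have FTn g : setpow F (r * h) g -> setpow T (2 * r * h0 * n) g.
  move=> /(setpow_sub FT); apply: setpow_leq => //.
  (* Since [n] is at least [1], rounding [h] down to a multiple of [h0] loses at most a factor
     [2]. *)
  have hn : h <= 2 * (h0 * n) by have := ltn_ceil h h00; rewrite -/n; clearbody n h0; nia.
  by have := leq_mul (leqnn r) hn; lia.
(* The element [b^-1 * g] has length [j <= h] in [F], while length exactly [h] is needed. Words for
   [1] of length [P] fill multiples of [P]; the residue is filled by a power of [f0], which the
   translate undoes. *)
exists (range (fun d : I * 'I_P => base d.1 * f0 ^- d.2)).
  exact: card_range_le.
move=> _ /(setpow_setmul hM hM1 hFM)[g gF [m Mm <-]].
set b := base (phi g).
have [bF bE] : setpow F (r * h) b /\ phi b = phi g.
  pose B := [set g' | setpow F (r * h) g' /\ phi g' = phi g].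
  exact: (xgetI (P := B) 1 (conj gF erefl)).
have [j jn Fj] := TF _ _ (phiP b g (FTn b bF) (FTn g gF) bE).
have jh : (j <= h)%N.
  by apply: (leq_trans jn); apply: leq_trans (leq_divM h h0); rewrite -/n /h0; nia.
pose i := ((h - j) %% P)%N.
have iP : (i < P)%N by rewrite ltn_mod.
exists (b * f0 ^- i); first by exists (phi g, Ordinal iP).
exists (f0 ^+ i * (b^-1 * g) * m).
  apply: setmul_setpow => //; first exact: leq_trans h0h.
  exists (f0 ^+ i * (b^-1 * g)); last by exists m.
  have -> : h = (i * 1 + j + (h - j) %/ P * P)%N by have := divn_eq (h - j) P; rewrite -/i; lia.
  rewrite -(mulg1 (_ * (_ * _))); apply: setpowM.
    by apply: setpowM => //; apply/setpowX/setpow1.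
  by rewrite -(expg1n _ ((h - j) %/ P)); apply: setpowX.
by rewrite !mulgA mulgVK mulgV mul1g.
Qed.
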